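(* Let $P$ be a standard Young tableau and let $l$ be the length of its first row. Suppose that, for some positive integers $k,m$, the first row of $P$ begins with $1,2,\dots,k$ (possibly followed by further entries $j,\dots$), and the second row of $P$ is $k+1,k+2,\dots,k+m$ (there may be further rows below). If $k+m-2>l$, then all elements of the Kazhdan--Lusztig right cell $\mathcal{C}_R(P)$ contain the pattern $3412$; in particular they are all non-smooth.
   Context: Permutations $w\in S_n$ are written in one-line notation $w=(w_1,\dots,w_n)$. $P(w)$ denotes the Robinson--Schensted (row) insertion tableau of $w$. Two elements of $S_n$ are in the same Kazhdan--Lusztig right cell if and only if they have the same insertion tableau; for a standard Young tableau $P$ with $n$ boxes, $\mathcal{C}_R(P)=\{w\in S_n: P(w)=P\}$ is the corresponding right cell. An element $w\in S_n$ contains the pattern $3412$ (resp. $4231$) if there are indices $a<b<c<d$ with $w_c<w_d<w_a<w_b$ (resp. $w_d<w_b<w_c<w_a$). The element $w$ is smooth if the Schubert variety $X_w=\overline{BwB/B}$ of type $A$ is smooth; equivalently, if $w$ contains neither $3412$ nor $4231$. *)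

(* Defs.v *)
From mathcomp Require Import all_boot all_order all_fingroup all_algebra.
From mathcomp Require Import mpoly.

Set Implicit Arguments.
Unset Strict Implicit.
Unset Printing Implicit Defensive.

Import GRing.Theory.
Local Open Scope ring_scope.

(* A tableau is the sequence of its rows, top row first (English notation);
   its entries are 1, ..., n.  Permutations are elements of 'S_n, acting on
   {0, ..., n-1}, so letters are shifted by one in one-line notation. *)

Definition tableau := seq (seq nat).

Definition column_lt (r r' : seq nat) : bool :=
  (size r' <= size r)%N && all2 ltn (take (size r') r) r'.

Definition standard_tableau (n : nat) (P : tableau) : bool :=
  [&& all (fun r => r != [::]) P,
      all (sorted ltn) P,
      sorted column_lt P
    & perm_eq (flatten P) (iota 1 n)].

(* x replaces the leftmost entry larger than x, which is bumped out (first
   component); if there is none, x is appended to the row. *)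
Fixpoint row_insert (r : seq nat) (x : nat) : option nat * seq nat :=
  if r is y :: r' then
    if (x < y)%N then (Some y, x :: r')
    else let: (b, r'') := row_insert r' x in (b, y :: r'')
  else (None, [:: x]).

Fixpoint tableau_insert (P : tableau) (x : nat) : tableau :=
  if P is r :: P' then
    match row_insert r x with
    | (Some y, r') => r' :: tableau_insert P' y
    | (None, r') => r' :: P'
    end
  else [:: [:: x]].

Definition one_line (n : nat) (w : 'S_n) : seq nat :=
  [seq (val (w i)).+1 | i <- enum 'I_n].

Definition insertion_tableau (n : nat) (w : 'S_n) : tableau :=
  foldl tableau_insert [::] (one_line w).

Definition right_cell (n : nat) (P : tableau) : {set 'S_n} :=
  [set w : 'S_n | insertion_tableau w == P].

Definition contains_3412 (n : nat) (w : 'S_n) : Prop :=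
  exists a b c d : 'I_n,
    [/\ (a < b)%N, (b < c)%N & (c < d)%N] /\
    [/\ (w c < w d)%N, (w d < w a)%N & (w a < w b)%N].

Section Schubert.

Variables (F : closedFieldType) (n : nat).
Implicit Types (g h u X : 'M[F]_n) (w : 'S_n) (p : {mpoly F[n * n]}).

(* Polynomials in n * n variables, as functions of the matrix entries. *)
Definition mx_eval p g : F := p.@[fun i => mxvec g 0 i].

(* The differential at g of the polynomial function p, in the direction X. *)
Definition mx_differential p g X : F :=
  \sum_(i < n * n) mx_eval (mderiv i p) g * mxvec X 0 i.

(* is_trig_mx is lower triangularity. *)
Definition borel h : bool := (h \in unitmx) && is_trig_mx h^T.

(* perm_mx w^-1 sends the basis column vector e_j to e_(w j). *)
Definition bruhat_cell w g : Prop :=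
  exists b1 b2 : 'M[F]_n,
    [/\ borel b1, borel b2 & g = b1 *m perm_mx w^-1 *m b2].

(* g B lies in X_w = closure(B w B / B).  As GL_n -> GL_n / B is open, this
   says that g lies in the Zariski closure of B w B in GL_n. *)
Definition in_schubert w g : Prop :=
  g \in unitmx /\
  forall p, (forall h, bruhat_cell w h -> mx_eval p h = 0) -> mx_eval p g = 0.

Definition lower_unipotent u : bool :=
  is_trig_mx u && [forall i, u i i == 1].

Definition strictly_lower X : bool :=
  is_trig_mx X && [forall i, X i i == 0].

(* The Zariski tangent space of X_w (with its reduced structure) at g B, read
   in the affine chart u |-> g u B of GL_n / B.  The domain of this chart is
   the affine space of lower unitriangular matrices u, and the point g B has
   coordinate u = 1. *)
Definition schubert_tangent w g X : Prop :=
  strictly_lower X /\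
  forall p,
    (forall u, lower_unipotent u -> in_schubert w (g *m u) ->
       mx_eval p u = 0) ->
    mx_differential p 1%:M X = 0.

(* The number of inversions of w, which is the dimension of X_w. *)
Definition perm_length w : nat :=
  #|[set ij : 'I_n * 'I_n | (ij.1 < ij.2)%N && (w ij.2 < w ij.1)%N]|.

(* X_w is smooth: at each of its points, the Zariski tangent space has
   dimension dim X_w. *)
Definition smooth w : Prop :=
  forall g, in_schubert w g ->
  exists U : {vspace 'M[F]_n},
    (forall X, X \in U <-> schubert_tangent w g X) /\ \dim U = perm_length w.

End Schubert.

Arguments smooth F [n] w.

(* Main.v *)
Require Import Defs.
From mathcomp Require Import all_boot all_order all_fingroup all_algebra.
From mathcomp Require Import mpoly ring zify.

Set Implicit Arguments.
Unset Strict Implicit.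
Unset Printing Implicit Defensive.

Import GRing.Theory.

(** Pattern. Row insertion keeps, in the reading word of the tableau, the
    relative order of any two consecutive letters i and i+1 [insertion_spec].
    Hence the letters 1, ..., k, which lie in one row of P, occur in increasing
    order in w, and so do k+1, ..., k+m. If k+2 precedes k-1 in w, then
    k+1, k+2, k-1, k form a 3412. Otherwise 1, ..., k-1, k+2, ..., k+m is an
    increasing subsequence of w with k+m-2 letters, more than the first row can
    have by Schensted's bound [increasing_size_first_row].

    Singularity. The tangent space of X_w at the base point is already too
    large. If i < j and the transposition (i j) is below w in the Bruhat order,
    then the whole line 1 + s E_ji lies in X_w, and E_ji is a tangent vector
    [schubert_tangent_delta]. These vectors are independent, so it suffices that
    the transpositions below w are more numerous than the inversions of w. They
    are never fewer, and they are strictly more numerous as soon as w contains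
    3412 or 4231 [inversion_count_transposition_count]. This is proved by
    deleting the largest value of w, or of its inverse: the deletion destroys at
    least as many transpositions as inversions, and if it destroys a pattern
    without leaving another one then it destroys one transposition more.

    The Bruhat order enters only through transpositions. If (i j) is below w,
    then undoing suitable inversions leads from w to (i j), and undoing an
    inversion shrinks the Schubert variety, because a line in the larger one
    degenerates to a point of the smaller cell [in_schubert_swap]. *)

(** * Counting transpositions below a permutation *)

Definition inverse_below n (w v : nat -> nat) :=
  forall x, x < n -> [/\ w x < n, v x < n, v (w x) = x & w (v x) = x].

Definition inversion_count n (w : nat -> nat) :=
  \sum_(i < n) \sum_(j < n) ((i < j) && (w j < w i)).

(** This is the Bruhat inequality (i j) <= w for the permutation w of [0, n)
    with inverse v: some position at most i carries a value at least j, and some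
    position at least j carries a value at most i. The second witness is named
    by its value c, which makes the condition symmetric in w and v. *)
Definition transposition_below (w v : nat -> nat) i j :=
  [&& i < j, has (fun a => j <= w a) (iota 0 i.+1)
           & has (fun c => j <= v c) (iota 0 i.+1)].

Definition transposition_count n w v :=
  \sum_(i < n) \sum_(j < n) transposition_below w v i j.

Definition occurs3412 n (w : nat -> nat) := exists a b c d,
  [/\ a < b, b < c, c < d & d < n] /\ [/\ w c < w d, w d < w a & w a < w b].

Definition occurs4231 n (w : nat -> nat) := exists a b c d,
  [/\ a < b, b < c, c < d & d < n] /\ [/\ w d < w b, w b < w c & w c < w a].

(** The induction needs both patterns: deleting the largest value from a
    permutation that contains 3412 may leave only a 4231. *)
Definition singular_pattern n w := occurs3412 n w \/ occurs4231 n w.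

Lemma inverse_below_sym n w v : inverse_below n w v -> inverse_below n v w.
Proof. by move=> wv x /wv[]. Qed.

Lemma occurs3412_sym n w v :
  inverse_below n w v -> occurs3412 n w -> occurs3412 n v.
Proof.
move=> wv [a [b [c [d [[ab bc cd dn] [h1 h2 h3]]]]]].
exists (w c), (w d), (w a), (w b).
have [wa _ va _] := wv a ltac:(lia); have [wb _ vb _] := wv b ltac:(lia).
have [wc _ vc _] := wv c ltac:(lia); have [wd _ vd _] := wv d ltac:(lia).
by rewrite va vb vc vd.
Qed.

Lemma occurs4231_sym n w v :
  inverse_below n w v -> occurs4231 n w -> occurs4231 n v.
Proof.
move=> wv [a [b [c [d [[ab bc cd dn] [h1 h2 h3]]]]]].
exists (w d), (w b), (w c), (w a).
have [wa _ va _] := wv a ltac:(lia); have [wb _ vb _] := wv b ltac:(lia).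
have [wc _ vc _] := wv c ltac:(lia); have [wd _ vd _] := wv d ltac:(lia).
by rewrite va vb vc vd.
Qed.

Lemma transposition_belowP w v i j :
  reflect [/\ i < j, exists2 a, a <= i & j <= w a & exists2 c, c <= i & j <= v c]
    (transposition_below w v i j).
Proof.
apply: (iffP and3P) => -[ij].
  move=> /hasP[a + h] /hasP[c + h']; rewrite !mem_iota => /andP[_ ai] /andP[_ ci].
  by split=> //; [exists a | exists c].
move=> [a ai h] [c ci h']; split=> //; apply/hasP.
  by exists a; rewrite ?mem_iota.
by exists c; rewrite ?mem_iota.
Qed.

Lemma transposition_below_sym w v i j :
  transposition_below w v i j = transposition_below v w i j.
Proof. by rewrite /transposition_below [X in _ && X]andbC. Qed.

Lemma sum_inverse_below n w v (F : nat -> nat) : inverse_below n w v ->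
  \sum_(i < n) F (w i) = \sum_(i < n) F i.
Proof.
move=> wv; rewrite -!(big_mkord xpredT) -(big_mkord xpredT (fun i => F (w i))).
rewrite -(big_map w xpredT F); apply: perm_big; apply: uniq_perm.
- rewrite map_inj_in_uniq ?iota_uniq // => x y.
  rewrite !mem_index_iota => /andP[_ /wv[_ _ vwx _]] /andP[_ /wv[_ _ vwy _]] e.
  by rewrite -vwx e vwy.
- exact: iota_uniq.
move=> x; rewrite mem_index_iota; apply/mapP/idP => [[y] | x_n].
  by rewrite mem_index_iota => /andP[_ /wv[? _ _ _]] ->.
by exists (v x); rewrite ?mem_index_iota; case: (wv x).
Qed.

Lemma inversion_count_sym n w v : inverse_below n w v ->
  inversion_count n w = inversion_count n v.
Proof.
move=> wv; rewrite /inversion_count exchange_big /=.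
rewrite -(sum_inverse_below (fun i => \sum_(j < n) ((i < j) && (v j < v i))) wv).
apply: eq_bigr => j _.
rewrite -(sum_inverse_below (fun i => nat_of_bool ((w j < i) && (v i < v (w j)))) wv).
apply: eq_bigr => i _.
have [_ _ -> _] := wv i (ltn_ord i); have [_ _ -> _] := wv j (ltn_ord j).
by rewrite andbC.
Qed.

Lemma transposition_count_sym n w v :
  transposition_count n w v = transposition_count n v w.
Proof.
by apply: eq_bigr => i _; apply: eq_bigr => j _; rewrite transposition_below_sym.
Qed.

Section DeleteTop.

Variables (n : nat) (w v : nat -> nat).
Hypothesis wv : inverse_below n.+1 w v.

Let p := v n.
Let w' := w \o bump p.
Let v' := unbump p \o v.

Let p_le : p < n.+1. Proof. by have [_ ? _ _] := wv (leqnn n.+1). Qed.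
Let wp : w p = n. Proof. by have [_ _ _ ?] := wv (leqnn n.+1). Qed.

Lemma value_lt_top x : x < n.+1 -> x != p -> w x < n.
Proof.
move=> x_n xp; have [wx _ vwx _] := wv x_n.
have: w x != n by apply: contra_neq xp => e; rewrite -vwx e.
by lia.
Qed.

Lemma delete_top_inverse : inverse_below n w' v'.
Proof.
move=> x x_n.
have bx : bump p x < n.+1 by rewrite /bump; lia.
have bp : bump p x != p by rewrite /bump; lia.
have [_ vx _ wvx] := wv (ltnW x_n : x < n.+1).
have vxp : v x != p.
  by apply/eqP => e; move: wvx; rewrite e wp; lia.
have [_ _ vwx _] := wv bx.
split; rewrite /w' /v' /=.
- exact: value_lt_top.
- by rewrite /unbump; lia.
- by rewrite vwx bumpK.
- by rewrite unbumpKcond (negPf vxp) /= ?add0n.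
Qed.

Lemma delete_top_below i j : i < n -> j < n ->
  transposition_below w' v' i j -> transposition_below w v i j.
Proof.
move=> i_n j_n /transposition_belowP[ij [a ai ja] [c ci jc]].
apply/transposition_belowP; split=> //.
  have [le_pi|lt_ip] := leqP p i; first by exists p => //; rewrite wp ltnW.
  exists a => //; move: ja.
  by rewrite /w' /= /bump [p <= a]leqNgt (leq_ltn_trans ai lt_ip).
by exists c => //; apply: leq_trans jc _; rewrite /v' /= /unbump leq_subr.
Qed.

(** The value n forms one inversion with each of the n - p entries after it. *)
Lemma inversion_count_delete_top :
  inversion_count n.+1 w = inversion_count n w' + (n - p).
Proof.
have w_lt (x : 'I_n) : w (bump p x) < n.
  by rewrite value_lt_top // /bump; have := ltn_ord x; lia.
rewrite /inversion_count (bigD1_ord (Ordinal p_le)) //= addnC; congr (_ + _).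
  apply: eq_bigr => i _; rewrite (bigD1_ord (Ordinal p_le)) //= wp.
  rewrite [n < _]ltnNge (ltnW (w_lt i)) andbF add0n.
  by apply: eq_bigr => j _; rewrite /w' /= [bump p i < _]ltnNge leq_bump2 -ltnNge.
rewrite (bigD1_ord (Ordinal p_le)) //= ltnn add0n.
transitivity (\sum_(i < n) (p <= i)).
  by apply: eq_bigr => i _; rewrite wp w_lt andbT /bump; congr nat_of_bool; lia.
have -> : n - p = \sum_(p <= i < n) 1 by rewrite sum_nat_const_nat muln1.
rewrite -(big_mkord xpredT (fun i => nat_of_bool (p <= i))).
rewrite (big_cat_nat (n := p)) //=.
rewrite big_nat big1 ?add0n; last by move=> i /andP[_ ip]; rewrite leqNgt ip.
by apply: eq_big_nat => i /andP[-> _].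
Qed.

Hypothesis wn_le : w n <= p.

(** The value n at position p and the last entry w n are the two witnesses. *)
Lemma transposition_below_top i : p <= i < n -> transposition_below w v i n.
Proof.
move=> /andP[pi i_n]; apply/transposition_belowP; split=> //.
  by exists p; rewrite ?wp.
have [_ _ vwn _] := wv (leqnn n.+1).
by exists (w n); [lia | rewrite vwn].
Qed.

(** The transpositions (i n) with p <= i < n are lost, and there are as many of
    them as inversions lost. The hypothesis that the last entry is at most p is
    what makes them all lie below w. *)
Lemma transposition_count_delete_top :
  transposition_count n w' v' + (n - p) +
    \sum_(i < n) \sum_(j < n)
      (transposition_below w v i j && ~~ transposition_below w' v' i j)
  <= transposition_count n.+1 w v.
Proof.
rewrite /transposition_count big_ord_recr /=.
apply: leq_trans (leq_addr _ _).
under [leqRHS]eq_bigr do rewrite big_ord_recr /=.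
rewrite big_split /= addnAC leq_add //.
  rewrite -big_split leq_sum // => i _; rewrite -big_split leq_sum // => j _.
  have := @delete_top_below i j (ltn_ord i) (ltn_ord j).
  by case: (transposition_below w' v' i j) => [->|] //;
    case: (transposition_below w v i j).
have -> : n - p = \sum_(p <= i < n) 1 by rewrite sum_nat_const_nat muln1.
rewrite -(big_mkord xpredT (fun i => nat_of_bool (transposition_below w v i n))).
rewrite [leqRHS](big_cat_nat (n := p)) //=.
apply: leq_trans (leq_addl _ _).
rewrite big_nat_cond [leqRHS]big_nat_cond; apply: leq_sum => i /andP[pi _].
by rewrite transposition_below_top.
Qed.

Lemma transposition_count_delete_top_lt i j : i < n -> j < n ->
  transposition_below w v i j -> ~~ transposition_below w' v' i j ->
  transposition_count n w' v' + (n - p) < transposition_count n.+1 w v.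
Proof.
move=> i_n j_n r nr'; apply: leq_trans transposition_count_delete_top.
rewrite -addn1 leq_add2l (bigD1 (Ordinal i_n)) //= (bigD1 (Ordinal j_n)) //=.
by rewrite r nr'.
Qed.

Lemma delete_top_occurs3412 a b c d :
    [/\ a < b, b < c, c < d & d < n.+1] -> [/\ w c < w d, w d < w a & w a < w b] ->
  [/\ a != p, b != p, c != p & d != p] -> singular_pattern n w'.
Proof.
move=> [ab bc cd dn] h [ap bp cp dp]; left.
exists (unbump p a), (unbump p b), (unbump p c), (unbump p d).
by rewrite /w' /= !unbumpK //; split=> //; rewrite /unbump; split; lia.
Qed.

Lemma delete_top_occurs4231 a b c d :
    [/\ a < b, b < c, c < d & d < n.+1] -> [/\ w d < w b, w b < w c & w c < w a] ->
  [/\ a != p, b != p, c != p & d != p] -> singular_pattern n w'.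
Proof.
move=> [ab bc cd dn] h [ap bp cp dp]; right.
exists (unbump p a), (unbump p b), (unbump p c), (unbump p d).
by rewrite /w' /= !unbumpK //; split=> //; rewrite /unbump; split; lia.
Qed.

(** From here on the deletion is supposed to lose only transpositions (i n);
    the aim is that it then preserves the presence of a bad pattern. *)
Hypothesis no_new_transposition : forall i j, i < n -> j < n ->
  transposition_below w v i j -> transposition_below w' v' i j.

(** The transposition (p n-1) is below w because of n and the last entry. Its
    staying below w' needs a value n-1 among the first p + 1 entries of w'. *)
Lemma second_top_position : 0 < n -> v n.-1 <= p.+1.
Proof.
move=> n_gt0; have [_ vn _ wvn] := wv (ltac:(lia) : n.-1 < n.+1).
have [|pn] := leqP n.-1 p; first by lia.
have r : transposition_below w v p n.-1.
  apply/transposition_belowP; split=> //; first by exists p => //; rewrite wp; lia.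
  have [_ _ vwn _] := wv (leqnn n.+1); exists (w n) => //; rewrite vwn; lia.
have /transposition_belowP[_ [a ap wa] _] :=
  @no_new_transposition p n.-1 ltac:(lia) ltac:(lia) r.
have bx : bump p a < n.+1 by rewrite /bump; lia.
have ba : bump p a <= p.+1 by rewrite /bump; lia.
have bp : bump p a != p by rewrite /bump; lia.
have := value_lt_top bx bp; rewrite /w' /= in wa => wa'.
have e : w (bump p a) = n.-1 by lia.
by have [_ _ vb _] := wv bx; rewrite -e vb.
Qed.

(** With n-1 as the large witness, (i c) is below w. Deleting n shifts the
    position c to the left, so (i c) stays below w' only if a value at most i
    occurs further right than c. Then (i c+1) is below w, and repeating the
    argument moves the small value to the last position n. *)
Lemma no_late_small_value c i :
  p < c < n -> v n.-1 <= i -> w c <= i -> i < p -> w n <= i.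
Proof.
move=> /andP[pc cn] qi wci ip.
have [_ vq _ wq] := wv (ltac:(lia) : n.-1 < n.+1).
have [_ _ vwc _] := wv (ltac:(lia) : c < n.+1).
have r k : c + k < n -> transposition_below w v i (c + k).
  elim: k => [|k IHk] ckn.
    apply/transposition_belowP; split; first by lia.
      by exists (v n.-1) => //; rewrite wq; lia.
    by exists (w c) => //; rewrite vwc; lia.
  have /transposition_belowP[_ _ [c1 c1i jc1]] :=
    @no_new_transposition i (c + k) ltac:(lia) ltac:(lia) (IHk ltac:(lia)).
  apply/transposition_belowP; split; first by lia.
    by exists (v n.-1) => //; rewrite wq; lia.
  by exists c1 => //; move: jc1; rewrite /v' /= /unbump; lia.
have := r (n.-1 - c) ltac:(lia); have -> : c + (n.-1 - c) = n.-1 by lia.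
move=> /(@no_new_transposition i n.-1 ltac:(lia) ltac:(lia)).
move=> /transposition_belowP[_ _ [c1 c1i]].
rewrite /v' /= /unbump => jc1.
have [_ vc1 _ wvc1] := wv (ltac:(lia) : c1 < n.+1).
have e : v c1 = n by lia.
by move: wvc1; rewrite e => ->.
Qed.

(** A pattern that avoids position p survives, and otherwise n is its largest
    letter. By [second_top_position] the value n-1 sits early enough to replace
    n, except in a 3412 when n-1 is at a position q < p. Then n-1 and n can
    serve as the letters 3 and 4, and the two small letters are compared with
    the last entry of w. *)
Lemma pattern_delete_top_no_new_transposition :
  singular_pattern n.+1 w -> singular_pattern n w'.
Proof.
have inj x y : x < n.+1 -> y < n.+1 -> w x = w y -> x = y.
  by move=> /wv[_ _ vwx _] /wv[_ _ vwy _] e; rewrite -vwx e vwy.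
have neq_p x : w x != n -> x != p by apply: contra_neq => ->.
have w_lt x : x < n.+1 -> w x < n.+1 by move=> /wv[].
move=> pat; have n_gt0 : 0 < n.
  by case: pat => [[a [b [c [d [[]]]]]]|[a [b [c [d [[]]]]]]]; lia.
have qp := second_top_position n_gt0; set q := v n.-1 in qp.
have [_ q_n _ wq] := wv (ltac:(lia) : n.-1 < n.+1); rewrite -/q in q_n wq.
have q_p : q != p by apply: neq_p; lia.
have wn_lt := w_lt n (leqnn _).
case: pat => [] [a [b [c [d [[ab bc cd dn] [h1 h2 h3]]]]]]; last first.
  have wa := w_lt a ltac:(lia).
  have [ap|ap] := eqVneq a p; last first.
    by apply: (@delete_top_occurs4231 a b c d); split=> //; apply: neq_p; lia.
  have qb : q < b.
    by have [e|] := eqVneq b q; [move: h2; rewrite e wq | ]; lia.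
  have wcq : w c != n.-1.
    by apply/eqP => e; have := inj c q ltac:(lia) ltac:(lia) ltac:(lia); lia.
  by apply: (@delete_top_occurs4231 q b c d); split=> //; lia.
have wb := w_lt b ltac:(lia).
have [bp|bp] := eqVneq b p; last first.
  by apply: (@delete_top_occurs3412 a b c d); split=> //; apply: neq_p; lia.
have [qp'|pq] := ltnP q p; last first.
  have qc : q < c.
    by have [e|] := eqVneq c q; [move: h1; rewrite e wq | ]; lia.
  apply: (@delete_top_occurs3412 a q c d); split=> //; rewrite ?wq; try lia.
  suff: w a != n.-1 by lia.
  by apply/eqP => e; have := inj a q ltac:(lia) ltac:(lia) ltac:(lia); lia.
have wd_lt : w d < n.-1 by lia.
have n_p : n != p by lia.
(* Both small letters exceed the last entry: with n-1 they form a 4231. *)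
have [wcn|wnc] := ltnP (w c) (w n); last first.
  have wcn : w c != w n by apply/eqP => /(inj _ _ _ _); lia.
  have dn' : d != n by apply: contraTneq h1 => ->; lia.
  by apply: (@delete_top_occurs4231 q c d n); split=> //; lia.
have [qwn|wnq] := ltnP q (w n).
  have := @no_late_small_value c (maxn q (w c)); rewrite -/q; lia.
(* At most w n <= q values are less than w n, and one of them, w c, occurs
   after q; so some entry before q exceeds w n. Together with n-1, w c and w n
   it forms a 3412. *)
have [r rq wr] : exists2 r, r < q & w n < w r.
  have [/hasP[r]|/hasPn h] := boolP (has (fun r => w n < w r) (iota 0 q)).
    by rewrite mem_iota => /= rq wr; exists r.
  suff : size (map w (c :: iota 0 q)) <= size (iota 0 (w n)).
    by rewrite size_map /= !size_iota; lia.
  apply: uniq_leq_size.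
    rewrite map_inj_in_uniq /= ?iota_uniq ?mem_iota ?andbT; first by lia.
    by move=> x y; rewrite !inE !mem_iota => hx hy; apply: inj; lia.
  move=> _ /mapP[x xs ->]; rewrite mem_iota /=.
  move: xs; rewrite inE => /orP[/eqP -> // | xs].
  have := h _ xs; rewrite mem_iota in xs; rewrite -leqNgt leq_eqVlt add0n.
  by case/orP=> // /eqP /(inj _ _ _ _); lia.
have wr_n := w_lt r ltac:(lia).
have wrq : w r != n.-1.
  by apply/eqP => e; have := inj r q ltac:(lia) ltac:(lia) ltac:(lia); lia.
have wrp : w r != n.
  by apply/eqP => e; have := inj r p ltac:(lia) ltac:(lia) ltac:(lia); lia.
by apply: (@delete_top_occurs3412 r q c n); split=> //; lia.
Qed.

End DeleteTop.

(** The first inequality is Deodhar's inequality at the identity; the second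
    one is the easy half of the Lakshmibai-Sandhya criterion. Both counts and
    both patterns are invariant under inversion, so the last entry may be
    supposed not to exceed the position of n. *)
Theorem inversion_count_transposition_count n w v : inverse_below n w v ->
  inversion_count n w <= transposition_count n w v /\
  (singular_pattern n w -> inversion_count n w < transposition_count n w v).
Proof.
elim: n w v => [|n IHn] w v wv.
  rewrite /inversion_count /transposition_count !big_ord0.
  by split=> // -[] [? [? [? [? [[]]]]]].
wlog wn_le : w v wv / w n <= v n.
  move=> IH; have [wn|/ltnW vn] := leqP (w n) (v n); first exact: IH.
  have vw := inverse_below_sym wv.
  have [le lt] := IH v w vw vn.
  rewrite (inversion_count_sym wv) transposition_count_sym; split=> // pat; apply: lt.
  by case: pat => [/(occurs3412_sym wv)|/(occurs4231_sym wv)]; [left|right].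
have [le lt] := IHn _ _ (delete_top_inverse wv).
have := transposition_count_delete_top wv wn_le.
rewrite (inversion_count_delete_top wv); split; first by lia.
move=> pat.
pose w' := w \o bump (v n); pose v' := unbump (v n) \o v.
have [/existsP[i /existsP[j /andP[r nr]]]|no_new] := boolP [exists i : 'I_n,
    exists j : 'I_n, transposition_below w v i j && ~~ transposition_below w' v' i j].
  have := transposition_count_delete_top_lt wv wn_le (ltn_ord i) (ltn_ord j) r nr; lia.
suff /lt : singular_pattern n (w \o bump (v n)) by lia.
apply: (pattern_delete_top_no_new_transposition wv wn_le) pat => i j i_n j_n r.
apply: contraNT no_new => nr; apply/existsP; exists (Ordinal i_n).
by apply/existsP; exists (Ordinal j_n); rewrite r.
Qed.

(** * Curves in Schubert varieties *)

Section Line.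

Local Open Scope ring_scope.

Variables (F : closedFieldType) (n : nat).
Implicit Types (A C : 'M[F]_n) (p : {mpoly F[n * n]}).

Definition line_poly p A C : {poly F} :=
  mmap (polyC : F -> {poly F}) (fun i => (mxvec A 0 i)%:P + (mxvec C 0 i)%:P * 'X) p.

Lemma line_polyE p A C s : (line_poly p A C).[s] = mx_eval p (A + s *: C).
Proof.
rewrite /line_poly /mx_eval mevalE /mmap horner_sum; apply: eq_bigr => m _.
rewrite hornerM hornerC horner_prod; congr (_ * _); apply: eq_bigr => i _.
by rewrite horner_exp !hornerE linearD linearZ !mxE; congr (_ ^+ _); ring.
Qed.

(** Chain rule: both sides are derivations in p, and they agree on constants
    and variables. *)
Lemma deriv_line_poly p A C :
  (line_poly p A C)^`() = \sum_i line_poly (mderiv i p) A C * (mxvec C 0 i)%:P.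
Proof.
pose D q := (line_poly q A C)^`() =
  \sum_i line_poly (mderiv i q) A C * (mxvec C 0 i)%:P.
have DD q r : D q -> D r -> D (q + r).
  rewrite /D /line_poly mmapD derivD => -> ->; rewrite -big_split; apply: eq_bigr => i _.
  by rewrite mderivD mmapD mulrDl.
have DC c : D c%:MP.
  rewrite /D /line_poly mmapC derivC big1 // => i _.
  by rewrite mderivC mmap0 mul0r.
have DM q r : D q -> D r -> D (q * r).
  rewrite /D /line_poly rmorphM derivM => -> ->; rewrite mulr_suml mulr_sumr.
  rewrite -big_split; apply: eq_bigr => i _.
  by rewrite mderivM mmapD !rmorphM /=; ring.
have subU j : (U_(j) - U_(j))%MM = 0%MM :> 'X_{1..n * n}.
  by apply/mnmP => k; rewrite mnmBE subnn mnm0E.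
have DX j : D 'X_j.
  rewrite /D /line_poly mmapX mmap1U derivD derivC derivM derivC derivX.
  rewrite mul0r !add0r mulr1 (bigD1 j) //= big1 ?addr0 => [|i ij]; last first.
    by rewrite mderivX mnm1E eq_sym (negPf ij) scale0r mmap0 mul0r.
  by rewrite mderivX mnm1E eqxx subU scale1r mpolyX0 rmorph1 mul1r.
elim/mpolyind: p; first by rewrite -mpolyC0; apply: DC.
move=> c m p _ _ Dp; apply: DD => //; rewrite -mul_mpolyC; apply: (DM); first exact: DC.
rewrite mpolyXE_id; apply: (big_ind D) => [||i _]; last first.
  elim: (m i) => [|k IHk]; first by rewrite expr0 -mpolyC1; apply: DC.
  by rewrite exprS; apply: (DM).
- exact: DM.
- by rewrite -mpolyC1; apply: DC.
Qed.

(** An algebraically closed field is infinite, so q has too many roots. *)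
Lemma horner_eq0_off0 (q : {poly F}) : (forall s, s != 0 -> q.[s] = 0) -> q = 0.
Proof.
move=> q0; suff : 'X * q == 0 by rewrite mulf_eq0 polyX_eq0 => /eqP.
apply/negPn/closed_nonrootP => -[s] /negP; apply; rewrite /root hornerM hornerX.
by have [->|/q0 ->] := eqVneq s 0; rewrite ?mul0r ?mulr0.
Qed.

Lemma mx_eval_line_closed p A C :
  (forall s, s != 0 -> mx_eval p (A + s *: C) = 0) ->
  mx_eval p A = 0.
Proof.
move=> p0; have q0 : line_poly p A C = 0.
  by apply: horner_eq0_off0 => s /p0; rewrite line_polyE.
by have := line_polyE p A C 0; rewrite q0 horner0 scale0r addr0.
Qed.

Lemma mx_differential_line p A C :
  (forall s, s != 0 -> mx_eval p (A + s *: C) = 0) ->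
  mx_differential p A C = 0.
Proof.
move=> p0; have q0 : line_poly p A C = 0.
  by apply: horner_eq0_off0 => s /p0; rewrite line_polyE.
have := congr1 (fun q => q.[0]) (deriv_line_poly p A C).
rewrite q0 linear0 horner0 horner_sum => /esym <-; apply: eq_bigr => i _.
by rewrite hornerM hornerC line_polyE scale0r addr0.
Qed.

End Line.

Section Cells.

Local Open Scope ring_scope.

Variables (F : closedFieldType) (n : nat).
Implicit Types (g h b A : 'M[F]_n) (w : 'S_n) (p : {mpoly F[n * n]}).

Lemma borelP b : (forall i j : 'I_n, (j < i)%N -> b i j = 0) ->
  (forall i, b i i != 0) -> borel b.
Proof.
move=> tri diag; have btri : is_trig_mx b^T by apply/is_trig_mxP => i j ij; rewrite mxE tri.
rewrite /borel btri unitmxE -det_tr det_trig // unitfE prodf_seq_neq0.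
by rewrite andbT; apply/allP => i _; rewrite mxE /= diag.
Qed.

Lemma borel1 : borel (1%:M : 'M[F]_n).
Proof.
apply: borelP => [i j ji|i]; rewrite mxE ?eqxx ?oner_eq0 //.
by case: eqVneq ji => // ->; rewrite ltnn.
Qed.

Lemma borelM b b' : borel b -> borel b' -> borel (b *m b').
Proof.
case/andP=> ub tb /andP[ub' tb']; rewrite /borel unitmx_mul ub ub' /=.
apply/is_trig_mxP => i j ij; rewrite !mxE big1 // => k _.
have [ki|ik] := leqP k i; last first.
  by have /is_trig_mxP/(_ _ _ ik) := tb'; rewrite mxE => ->; rewrite mulr0.
have kj := leq_ltn_trans ki ij.
by have /is_trig_mxP/(_ _ _ kj) := tb; rewrite mxE => ->; rewrite mul0r.
Qed.

Lemma borel_transvection (c d : 'I_n) (a : F) : (c < d)%N ->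
  borel (1%:M + a *: delta_mx c d).
Proof.
move=> cd; apply: borelP => [i j ji|i]; rewrite !mxE.
  have /negPf -> : i != j by apply: contraTneq ji => ->; rewrite ltnn.
  have /negPf -> : ~~ ((i == c) && (j == d)).
    by apply: contraTN cd => /andP[/eqP <- /eqP <-]; rewrite -leqNgt ltnW.
  by rewrite mulr0 addr0.
have /negPf -> : ~~ ((i == c) && (i == d)).
  by apply: contraTN cd => /andP[/eqP <- /eqP <-]; rewrite ltnn.
by rewrite eqxx mulr0 addr0 oner_eq0.
Qed.

(** In the rows and columns x < y this is the identity
    [1 0; s 1] = [-1/s 1; 0 s] [0 1; 1 0] [1 1/s; 0 1],
    which shows that the lower transvection meets the cell of (x y). *)
Lemma lower_transvection_factor (x y : 'I_n) (s : F) : (x < y)%N -> s != 0 ->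
  exists2 b : 'M[F]_n, borel b &
    1%:M + s *: delta_mx y x = b *m perm_mx (tperm x y) *m (1%:M + s^-1 *: delta_mx x y).
Proof.
move=> xy s0; have xNy : x != y by apply: contraTneq xy => ->; rewrite ltnn.
pose b : 'M[F]_n := \matrix_(i, j)
  if i == j then (if i == x then - s^-1 else if i == y then s else 1)
  else ((i == x) && (j == y))%:R.
exists b.
  apply: borelP => [i j ji|i]; rewrite mxE.
    have /negPf -> : i != j by apply: contraTneq ji => ->; rewrite ltnn.
    have /negPf -> // : ~~ ((i == x) && (j == y)).
    by apply: contraTN xy => /andP[/eqP <- /eqP <-]; rewrite -leqNgt ltnW.
  by rewrite eqxx; do 2?case: ifP => _; rewrite ?oppr_eq0 ?invr_eq0 ?oner_eq0.
rewrite -[tperm x y]invgK -col_permE tpermV mulmxDr mulmx1 -scalemxAr.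
apply/matrixP => i j; rewrite !mxE (bigD1 x) //= big1 ?addr0; last first.
  by move=> k kx; rewrite !mxE (negPf kx) mulr0.
rewrite !mxE eqxx /= tpermL.
have yNx : y != x by rewrite eq_sym.
case: tpermP => [->|->|/eqP jx /eqP jy];
  rewrite ?eqxx ?(negPf xNy) ?(negPf yNx) ?(negPf jx) ?(negPf jy) /=.
- have [->|ix] := eqVneq i x; rewrite ?(negPf xNy) /=; first by ring.
  by case: (eqVneq i y) => _ /=; ring.
- have [->|ix] := eqVneq i x; rewrite ?(negPf xNy) /=; first by ring.
  by case: (eqVneq i y) => _ /=; field.
- by rewrite !andbF !mulr0 !addr0; case: eqVneq => // ->; rewrite (negPf jx) (negPf jy).
Qed.

Lemma delta_mulmx_perm w (c d : 'I_n) :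
  delta_mx (w c) (w d) *m perm_mx w^-1 = perm_mx w^-1 *m delta_mx c d :> 'M[F]_n.
Proof.
rewrite -col_permE -row_permE; apply/matrixP => i j; rewrite !mxE.
by rewrite (inj_eq perm_inj) (can2_eq (permKV w) (permK w)).
Qed.

(** The left-hand upper factor of the transvection is absorbed by b1; the
    right-hand one, conjugated by the smaller permutation, becomes a
    transvection in position (c, d), upper because c < d, absorbed by b2. *)
Lemma bruhat_cell_step w (c d : 'I_n) b1 b2 s :
    (c < d)%N -> (w d < w c)%N -> borel b1 -> borel b2 -> s != 0 ->
  bruhat_cell w (b1 *m (1%:M + s *: delta_mx (w c) (w d))
                    *m perm_mx (tperm c d * w)^-1 *m b2).
Proof.
move=> cd wdc bb1 bb2 s0.
have [b bb ->] := lower_transvection_factor wdc s0.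
exists (b1 *m b), ((1%:M + s^-1 *: delta_mx c d) *m b2).
split; [exact: borelM | by apply: borelM => //; apply: borel_transvection |].
have e : (tperm (w d) (w c) * (tperm c d * w)^-1 = w^-1)%g.
  rewrite invMg tpermV mulgA -[(w^-1)%g in RHS]mulg1 -(tperm2 c d) mulgA; congr (_ * _)%g.
  apply: (mulgI w); rewrite mulgA.
  by rewrite -[tperm (w d) _]tpermJ tpermC /conjg !mulgA mulgV mul1g -mulgA mulgV mulg1.
rewrite -!mulmxA -e perm_mxM; do 2!congr (_ *m _); rewrite -!mulmxA; congr (_ *m _).
rewrite !mulmxA; congr (_ *m _); rewrite mulmxDl mulmxDr mul1mx mulmx1; congr (_ + _).
have -> : w d = (tperm c d * w)%g c by rewrite permM tpermL.
have -> : w c = (tperm c d * w)%g d by rewrite permM tpermR.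
by rewrite -scalemxAl -scalemxAr delta_mulmx_perm.
Qed.

(** For s <> 0 the point lies in the cell of w; the point s = 0, which lies in
    the cell of the smaller permutation, follows by density of F minus 0 in the
    line. *)
Lemma vanish_below_line w (c d : 'I_n) b1 b2 s p :
    (c < d)%N -> (w d < w c)%N -> borel b1 -> borel b2 ->
    (forall h, bruhat_cell w h -> mx_eval p h = 0) ->
  mx_eval p (b1 *m (1%:M + s *: delta_mx (w c) (w d))
                    *m perm_mx (tperm c d * w)^-1 *m b2) = 0.
Proof.
move=> cd wdc bb1 bb2 p0; set g := (X in mx_eval p X).
pose C := b1 *m delta_mx (w c) (w d) *m perm_mx (tperm c d * w)^-1 *m b2.
have e t : g + t *: C
    = b1 *m (1%:M + (s + t) *: delta_mx (w c) (w d)) *m perm_mx (tperm c d * w)^-1 *m b2.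
  rewrite /g scalerDl addrA [in RHS]mulmxDr ![in RHS]mulmxDl; congr (_ + _).
  by rewrite /C -scalemxAr -!scalemxAl.
have [s0|s0] := eqVneq s 0; last by rewrite /g; apply: p0; exact: bruhat_cell_step.
apply: (mx_eval_line_closed (C := C)) => t t0; rewrite e s0 add0r.
by apply: p0; exact: bruhat_cell_step.
Qed.

Lemma in_schubert_swap w (c d : 'I_n) g : (c < d)%N -> (w d < w c)%N ->
  in_schubert (tperm c d * w) g -> in_schubert w g.
Proof.
move=> cd wdc [ug g0]; split=> // p p0; apply: g0 => _ [b1 [b2 [bb1 bb2 ->]]].
have := vanish_below_line 0 cd wdc bb1 bb2 p0.
by rewrite scale0r addr0 mulmx1.
Qed.

Lemma in_schubert_transvection (i j : 'I_n) s : (i < j)%N ->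
  in_schubert (tperm i j) (1%:M + s *: delta_mx j i : 'M[F]_n).
Proof.
move=> ij; have u : 1%:M + s *: delta_mx j i \in @unitmx F n.
  have /andP[+ _] := borel_transvection s ij.
  by rewrite -unitmx_tr linearD linearZ /= trmx1 trmx_delta.
split=> // p p0.
have := @vanish_below_line (tperm i j) i j 1%:M 1%:M s p ij.
rewrite tpermL tpermR tperm2 invg1 perm_mx1 mul1mx !mulmx1 => -> //; exact: borel1.
Qed.

(** The line 1 + s E_ji stays inside X_w, and E_ji is its velocity. *)
Lemma schubert_tangent_delta w (i j : 'I_n) : (i < j)%N ->
    (forall g : 'M[F]_n, in_schubert (tperm i j) g -> in_schubert w g) ->
  schubert_tangent w (1%:M : 'M[F]_n) (delta_mx j i).
Proof.
move=> ij sub; have lt_neq (x y : 'I_n) : (x < y)%N -> (x == y) = false.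
  by move=> xy; apply: contraTF xy => /eqP ->; rewrite ltnn.
have off (x y : 'I_n) : (x <= y)%N -> (x == j) && (y == i) = false.
  by apply: contraTF => /andP[/eqP -> /eqP ->]; rewrite -ltnNge.
split; first apply/andP; first split.
- by apply/is_trig_mxP => x y xy; rewrite mxE off // ltnW.
- by apply/forallP => x; rewrite mxE off.
move=> p p0; apply: mx_differential_line => s _; apply: p0; last first.
  by rewrite mul1mx; apply/sub/in_schubert_transvection.
apply/andP; split.
  by apply/is_trig_mxP => x y xy; rewrite !mxE off ?(ltnW xy) // lt_neq // mulr0 addr0.
by apply/forallP => x; rewrite !mxE off // eqxx mulr0 addr0.
Qed.

Lemma dim_ge_delta (U : {vspace 'M[F]_n}) (S : {set 'I_n * 'I_n}) :
  (forall ij, ij \in S -> delta_mx ij.2 ij.1 \in U) -> (#|S| <= \dim U)%N.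
Proof.
move=> SU; pose X := [tuple delta_mx (enum_val q).2 (enum_val q).1 : 'M[F]_n | q < #|S|].
have XU : (<<X>> <= U)%VS.
  apply/span_subvP => _ /tnthP[q ->]; rewrite tnth_mktuple; apply: SU.
  exact: enum_valP.
apply: leq_trans (dimvS XU); suff /eqP -> : free X by rewrite size_tuple.
apply/freeP => k k0 r.
have := congr1 (fun A : 'M_n => A (enum_val r).2 (enum_val r).1) k0.
rewrite summxE (bigD1 r) // big1 => [|q qr]; rewrite -tnth_nth tnth_mktuple !mxE.
  by rewrite !eqxx /= mulr1 addr0.
rewrite andbC -xpair_eqE -!surjective_pairing eq_sym (inj_eq enum_val_inj) (negPf qr).
by rewrite mulr0.
Qed.

End Cells.

(** * Transpositions in the Bruhat order *)

Section Weight.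

Variable n : nat.
Implicit Types w : 'S_n.

(** This sum is bounded and grows when an inversion is undone, which makes the
    descent from w to (i j) terminate. *)
Definition weight w := \sum_(x < n) x * w x.

Lemma weight_le w : weight w <= n * (n * n).
Proof.
apply: (@leq_trans (\sum_(x < n) n * n)); last by rewrite sum_nat_const card_ord.
by apply: leq_sum => x _; rewrite leq_mul // ltnW.
Qed.

Lemma weight_swap w (c d : 'I_n) : c < d -> w d < w c ->
  weight w < weight (tperm c d * w).
Proof.
move=> cd wdc; have dc : d != c by apply: contraTneq cd => ->; rewrite ltnn.
rewrite /weight (bigD1 c) //= (bigD1 d) //= [ltnRHS](bigD1 c) //= [in ltnRHS](bigD1 d) //=.
rewrite !permM tpermL tpermR !addnA.
have -> : \sum_(x < n | (x != c) && (x != d)) x * (tperm c d * w)%g x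
        = \sum_(x < n | (x != c) && (x != d)) x * w x.
  by apply: eq_bigr => x /andP[xc xd]; rewrite permM tpermD // eq_sym.
rewrite ltn_add2r; nia.
Qed.

End Weight.

Section Chain.

Variables (n : nat) (i j : 'I_n).
Hypothesis ij : i < j.
Implicit Types w : 'S_n.

(** The condition [transposition_below], with the second witness given by its
    position. *)
Definition tperm_below w :=
  [exists a : 'I_n, (a <= i) && (j <= w a)] && [exists b : 'I_n, (j <= b) && (w b <= i)].

(** A permutation above (i j) from which no inversion can be undone without
    losing that property must be (i j) itself. *)
Section Stuck.

Variable w : 'S_n.
Hypothesis w_above : tperm_below w.
Hypothesis stuck : forall c d : 'I_n, c < d -> w d < w c -> ~~ tperm_below (tperm c d * w).

Lemma stuck_swap (c d a b : 'I_n) : c < d -> w d < w c ->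
  a <= i -> j <= w (tperm c d a) -> j <= b -> w (tperm c d b) <= i -> False.
Proof.
move=> cd wdc ai ja jb bi; have /negP[] := stuck cd wdc; apply/andP; split.
  by apply/existsP; exists a; rewrite permM ai.
by apply/existsP; exists b; rewrite permM jb.
Qed.

(** Both sets are differences of [0, i] and its preimage under w, which have the
    same size. *)
Lemma crossing_balance :
  #|[set x : 'I_n | x <= i < w x]| = #|[set x : 'I_n | w x <= i < x]|.
Proof.
pose L := [set x : 'I_n | x <= i].
have -> : [set x : 'I_n | x <= i < w x] = L :\: (w @^-1: L).
  by apply/setP => x; rewrite !inE -ltnNge andbC.
have -> : [set x : 'I_n | w x <= i < x] = (w @^-1: L) :\: L.
  by apply/setP => x; rewrite !inE -ltnNge andbC.
have := cardsID (w @^-1: L) L; have := cardsID L (w @^-1: L).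
by rewrite [L :&: _]setIC (card_preimset _ (@perm_inj _ w)) => <- /addnI.
Qed.

(** If two entries cross upward then by [crossing_balance] two entries cross
    downward. The inversion formed by one entry of each kind can be undone,
    because the other two remain as witnesses. *)
Lemma stuck_unique_top (a a' : 'I_n) :
  a <= i -> j <= w a -> a' <= i -> j <= w a' -> a = a'.
Proof.
wlog lt_aa' : a a' / a < a'.
  move=> H h1 h2 h3 h4; case: (ltngtP a a') => [| |/val_inj //] lt; first exact: H.
  by symmetry; apply: H.
move=> ai ja ai' ja'.
have /andP[_ /existsP[b /andP[jb bi]]] := w_above.
have : 1 < #|[set x : 'I_n | w x <= i < x]|.
  rewrite -crossing_balance; apply/card_gt1P; exists a, a'; rewrite !inE.
  by split; [lia | lia | apply: contraTneq lt_aa' => ->; rewrite ltnn].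
case/card_gt1P => e [e' []]; rewrite !inE.
wlog eb : e e' / e != b.
  move=> H he he' ee'; have [eb|] := eqVneq e b; last by move=> eb; apply: (H e e').
  by apply: (H e' e) => //; rewrite -?eb eq_sym.
move=> he _ _.
exfalso; apply: (@stuck_swap a' e a b) => //; try lia.
  rewrite tpermD //; apply/eqP => e1; subst; lia.
rewrite tpermD //; apply/eqP => e1; subst; lia.
Qed.

Lemma stuck_unique_bottom (b b' : 'I_n) :
  j <= b -> w b <= i -> j <= b' -> w b' <= i -> b = b'.
Proof.
wlog lt_bb' : b b' / b < b'.
  move=> H h1 h2 h3 h4; case: (ltngtP b b') => [| |/val_inj //] lt; first exact: H.
  by symmetry; apply: H.
move=> jb bi jb' bi'.
have /andP[/existsP[a /andP[ai ja]] _] := w_above.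
have : 1 < #|[set x : 'I_n | x <= i < w x]|.
  rewrite crossing_balance; apply/card_gt1P; exists b, b'; rewrite !inE.
  by split; [lia | lia | apply: contraTneq lt_bb' => ->; rewrite ltnn].
case/card_gt1P => e [e' []]; rewrite !inE.
wlog ea : e e' / e != a.
  move=> H he he' ee'; have [eb|] := eqVneq e a; last by move=> ea; apply: (H e e').
  by apply: (H e' e) => //; rewrite -?eb eq_sym.
move=> he _ _.
exfalso; apply: (@stuck_swap e b a b') => //; try lia.
  rewrite tpermD //; apply/eqP => e1; subst; lia.
rewrite tpermD //; apply/eqP => e1; subst; lia.
Qed.

(** The upward witness a is at position i, for otherwise the entries at a and i
    form an inversion that can be undone; its value is j, for otherwise the
    entry with value j gives such an inversion. *)
Lemma stuck_top : w i = j.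
Proof.
have /andP[/existsP[a /andP[ai ja]] /existsP[b /andP[jb bi]]] := w_above.
have ordE (x y : 'I_n) : x != y -> x <> y :> nat by move=> /eqP xy /val_inj.
have ai' : a = i.
  apply/eqP/negP => /negP ai'; have lt : a < i by have := ordE _ _ ai'; lia.
  have [wai|wia] := leqP (w a) (w i).
    by have e := @stuck_unique_top a i ai ja (leqnn i) ltac:(lia); rewrite e eqxx in ai'.
  apply: (@stuck_swap a i i b) => //; first by rewrite tpermR.
  rewrite tpermD //; apply/eqP => e1; subst; lia.
subst a; apply/eqP/negP => /negP wij.
have lt : j < w i by have := ordE _ _ wij; lia.
pose d := (w^-1 j)%g; have wd : w d = j by rewrite permKV.
have [di|id] := leqP d i.
  by have e := @stuck_unique_top d i di ltac:(by rewrite wd) ai ja; rewrite -e wd eqxx in wij.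
apply: (@stuck_swap i d i b) => //; rewrite ?tpermL ?wd //.
rewrite tpermD //; first by apply: contraTneq ij => ->; rewrite -leqNgt.
by apply: contraTneq ij => db; rewrite -leqNgt -wd db.
Qed.

Lemma stuck_bottom : w j = i.
Proof.
have /andP[/existsP[a /andP[ai ja]] /existsP[b /andP[jb bi]]] := w_above.
have ordE (x y : 'I_n) : x != y -> x <> y :> nat by move=> /eqP xy /val_inj.
have bj' : b = j.
  apply/eqP/negP => /negP bj'; have lt : j < b by have := ordE _ _ bj'; lia.
  have [wjb|wbj] := leqP (w j) (w b).
    by have e := @stuck_unique_bottom b j jb bi (leqnn j) ltac:(lia); rewrite e eqxx in bj'.
  apply: (@stuck_swap j b a j) => //; last by rewrite tpermL.
  rewrite tpermD //; apply/eqP => e1; subst; lia.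
subst b; apply/eqP/negP => /negP wji.
have lt : w j < i by have := ordE _ _ wji; lia.
pose d := (w^-1 i)%g; have wd : w d = i by rewrite permKV.
have [jd|dj] := leqP j d.
  by have e := @stuck_unique_bottom d j jd ltac:(by rewrite wd) jb bi; rewrite -e wd eqxx in wji.
apply: (@stuck_swap d j a j) => //; rewrite ?tpermR ?wd //.
rewrite tpermD //; last by apply: contraTneq ij => ->; rewrite -leqNgt.
by apply: contraTneq ij => da; rewrite -leqNgt -wd da.
Qed.

(** No inversion avoids the positions i and j, so w is increasing on the other
    positions, and an increasing permutation of a finite set is the identity. *)
Lemma stuck_eq_tperm : w = tperm i j.
Proof.
have wi := stuck_top; have wj := stuck_bottom.
have incr (x y : 'I_n) : x != i -> x != j -> y != i -> y != j -> x < y -> w x < w y.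
  move=> xi xj yi yj xy; rewrite ltnNge leq_eqVlt; apply/norP; split.
    by apply: contraTneq xy => /val_inj /perm_inj ->; rewrite ltnn.
  apply/negP => wyx; apply: (@stuck_swap x y i j) => //; by rewrite tpermD // (wi, wj).
have fixed m (x : 'I_n) : x < m -> x != i -> x != j -> w x = x.
  elim: m x => // m IHm x; rewrite ltnS => xm xi xj.
  case: (ltngtP (w x) x) => [lt|gt|/val_inj //].
    have wxi : w x != i by apply: contra_neq xj => e; apply: (@perm_inj _ w); rewrite e.
    have wxj : w x != j by apply: contra_neq xi => e; apply: (@perm_inj _ w); rewrite e.
    by apply: (@perm_inj _ w); apply: IHm => //; apply: leq_trans lt xm.
  pose z := (w^-1 x)%g; have wz : w z = x by rewrite permKV.
  have zi : z != i by apply: contra_neq xj => e; rewrite -wz e.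
  have zj : z != j by apply: contra_neq xi => e; rewrite -wz e.
  case: (ltngtP z x) => [zx|xz|/val_inj e]; last by rewrite -{1}e.
    have := IHm z (leq_trans zx xm) zi zj; rewrite wz => e.
    by rewrite -e ltnn in zx.
  by have := incr _ _ xi xj zi zj xz; rewrite wz; lia.
apply/permP => x; case: tpermP => [->|->|/eqP xi /eqP xj] //.
exact: (@fixed x.+1).
Qed.

End Stuck.
End Chain.

(** Undoing inversions while staying above (i j) ends at (i j), and every step
    goes to a smaller Schubert variety. *)
Lemma in_schubert_tperm_below (F : closedFieldType) n (w : 'S_n) (i j : 'I_n) (g : 'M[F]_n) :
  i < j -> tperm_below i j w -> in_schubert (tperm i j) g -> in_schubert w g.
Proof.
move=> ij; have [m] := ubnP (n * (n * n) - weight w); elim: m w => // m IHm w lem w_above.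
have [|] := boolP [exists c : 'I_n, exists d : 'I_n,
    [&& c < d, w d < w c & tperm_below i j (tperm c d * w)]].
  case/existsP => c /existsP[d /and3P[cd wdc tperm_below']] g_in.
  apply: (in_schubert_swap cd wdc); apply: IHm => //.
  by have := @weight_swap _ w c d cd wdc; have := weight_le (tperm c d * w); lia.
move=> no; rewrite -(@stuck_eq_tperm _ i j ij w w_above) // => c d cd wdc.
apply: contraNN no => h; apply/existsP; exists c; apply/existsP; exists d.
by rewrite cd wdc.
Qed.

(** * Row insertion *)

(** Rows are read from the bottom to the top, so that inserting x amounts to
    appending it to the word and then moving letters to the left. *)
Definition reading_word (P : tableau) := flatten (rev P).

Definition bumped (o : option nat) : seq nat := if o is Some y then [:: y] else [::].

Lemma row_insert_perm r x :
  perm_eq (bumped (row_insert r x).1 ++ (row_insert r x).2) (x :: r).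
Proof.
elim: r => [|z r IHr] //=; case: ifP => _ /=.
  by rewrite (perm_catCA [:: z] [:: x]).
case: (row_insert r x) IHr => b r' /= IHr.
rewrite perm_sym (perm_catCA [:: x] [:: z]) perm_sym (perm_catCA (bumped b) [:: z]).
by rewrite /= perm_cons.
Qed.

Lemma row_insert_gt r x y : (row_insert r x).1 = Some y -> x < y.
Proof.
elim: r => [|z r IHr] //=; case: ifP => [lt [<-] //|_].
by case: (row_insert r x) IHr.
Qed.

Lemma row_insert_path r x z : path ltn z r -> x \notin r -> z < x ->
  path ltn z (row_insert r x).2.
Proof.
elim: r z => [|y r IHr] z /=; first by rewrite andbT.
move=> /andP[zy yr]; rewrite inE negb_or => /andP[xy xr] zx.
case: ifP => [lt|ge] /=; first by rewrite zx; case: r yr {IHr xr} => //= u r; lia.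
have := IHr y yr xr; case: (row_insert r x) => b r' /= IH; rewrite zy IH //; lia.
Qed.

Lemma row_insert_sorted r x : sorted ltn r -> x \notin r ->
  sorted ltn (row_insert r x).2.
Proof.
case: r => //= y r yr; rewrite inE negb_or => /andP[xy xr].
case: ifP => [lt|ge] /=; first by case: r yr {xr} => //= u r; lia.
have := row_insert_path yr xr; case: (row_insert r x) => b r' /= IH; apply: IH; lia.
Qed.

Lemma filter_pred2_path i z r : path ltn z r -> i < z -> 
  filter (pred2 i i.+1) r = [::].
Proof.
move=> zr iz; apply/eqP; rewrite -[_ == _]negbK -has_filter; apply/hasPn => u ur /=.
have /allP/(_ u ur) : all (ltn z) r by exact: (order_path_min ltn_trans).
by rewrite /=; lia.
Qed.

(** Filtering a word with distinct letters on {i, i+1} records which of the two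
    letters comes first. Inserting x turns a word r1 y r2 x into y r1 x r2: the
    bumped y passes letters less than x, and x passes letters greater than y, so
    no letter passes a consecutive one. *)
Lemma row_insert_filter i r x : sorted ltn r -> x \notin r ->
  filter (pred2 i i.+1) (bumped (row_insert r x).1 ++ (row_insert r x).2)
  = filter (pred2 i i.+1) (r ++ [:: x]).
Proof.
elim: r => [|z r IHr] //= zr; rewrite inE negb_or => /andP[xz xr].
pose p := pred2 i i.+1; rewrite -/p.
case: ifP => [xz_lt|zx].
  suff e : filter p (x :: r) = filter p (r ++ [:: x]) by rewrite /= -e.
  rewrite filter_cat /=; case: ifP => px; last by rewrite cats0.
  by rewrite (filter_pred2_path zr) //; move: px; rewrite /p /=; lia.
have := IHr (path_sorted zr) xr; have := @row_insert_gt r x.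
case: (row_insert r x) => [[y|] r'] /= gt; rewrite -/p => IH; last by rewrite -IH.
rewrite -IH; have := gt y erefl; rewrite /p /= => xy.
by case: ifP => // y_i; case: ifP => // z_i; lia.
Qed.

Lemma tableau_insert_spec P x : all (sorted ltn) P -> uniq (x :: flatten P) ->
  [/\ perm_eq (flatten (tableau_insert P x)) (x :: flatten P),
      all (sorted ltn) (tableau_insert P x)
    & forall i, filter (pred2 i i.+1) (reading_word (tableau_insert P x)) =
                filter (pred2 i i.+1) (reading_word P ++ [:: x])].
Proof.
elim: P x => [|r P IHP] x //= /andP[sr sP].
rewrite mem_cat negb_or cat_uniq => /andP[/andP[xr xP] /and3P[ur rP uP]].
have := row_insert_perm r x; have := row_insert_sorted sr xr.
have := row_insert_filter _ sr xr.
case: (row_insert r x) => [[y|] r'] /= filt sr' perm; last first.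
  split=> [||i]; first by rewrite -cat_cons perm_cat2r.
    by rewrite sr'.
  by rewrite /reading_word !rev_cons !flatten_rcons -catA !(filter_cat _ (flatten _)) -filt.
have yP : uniq (y :: flatten P).
  have : uniq (x :: r ++ flatten P) by rewrite /= mem_cat negb_or xr xP cat_uniq ur rP.
  have /perm_uniq -> : perm_eq (x :: r ++ flatten P) (y :: r' ++ flatten P).
    by rewrite -!cat_cons perm_cat2r perm_sym.
  by apply: subseq_uniq; rewrite /= eqxx suffix_subseq.
have [IH1 IH2 IH3] := IHP y sP yP; split=> [||i].
- apply: (@perm_trans _ (r' ++ [:: y] ++ flatten P)); first by rewrite perm_cat2l.
  by rewrite perm_catCA catA -cat_cons perm_cat2r.
- by rewrite sr'.
rewrite /reading_word !rev_cons !flatten_rcons filter_cat.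
rewrite [filter _ (flatten (rev (tableau_insert P y)))]IH3.
have {}filt : filter (pred2 i i.+1) ([:: y] ++ r') = filter (pred2 i i.+1) (r ++ [:: x]).
  exact: filt.
by rewrite !filter_cat -!catA; congr (_ ++ _); rewrite -!filter_cat filt.
Qed.

(** The reading word of the tableau and the inserted word agree on the order of
    any two consecutive letters. *)
Lemma insertion_spec s : uniq s -> let T := foldl tableau_insert [::] s in
  [/\ perm_eq (flatten T) s, all (sorted ltn) T
    & forall i, filter (pred2 i i.+1) (reading_word T) = filter (pred2 i i.+1) s].
Proof.
elim/last_ind: s => [|s x IHs] //=; rewrite rcons_uniq => /andP[xs us].
rewrite foldl_rcons; have [IH1 IH2 IH3] := IHs us.
have [||S1 S2 S3] := @tableau_insert_spec (foldl tableau_insert [::] s) x => //.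
  by rewrite /= (perm_uniq IH1) us (perm_mem IH1) xs.
split=> // [|i]; first by rewrite (perm_trans S1) // perm_sym perm_rcons perm_cons perm_sym.
by rewrite S3 -cats1 !filter_cat IH3.
Qed.

Lemma filter_row i r : sorted ltn r -> i \in r -> i.+1 \in r ->
  filter (pred2 i i.+1) r = [:: i; i.+1].
Proof.
move=> sr ir i1r; apply: (irr_sorted_eq ltn_trans ltnn).
- exact: (sorted_filter ltn_trans).
- by rewrite /= ltnSn.
by move=> x; rewrite mem_filter !inE /=; case: eqP => [->|_] /=; [rewrite ir | case: eqP => [->|]].
Qed.

Lemma reading_word_filter P r i : all (sorted ltn) P -> uniq (flatten P) ->
  r \in P -> i \in r -> i.+1 \in r ->
  filter (pred2 i i.+1) (reading_word P) = [:: i; i.+1].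
Proof.
rewrite /reading_word; elim: P => //= q P IHP /andP[sq sP].
rewrite cat_uniq rev_cons flatten_rcons filter_cat => /and3P[uq qP uP].
have no (u : seq nat) : i \notin u -> i.+1 \notin u -> filter (pred2 i i.+1) u = [::].
  move=> iu i1u; apply/eqP; rewrite -[_ == _]negbK -has_filter; apply/hasPn => x xu /=.
  by apply/norP; split; [apply: contraNneq iu | apply: contraNneq i1u] => <-.
rewrite inE => /orP[/eqP -> ir i1r | rP ir i1r].
  have mem_rev z : z \in q -> z \notin flatten (rev P).
    move=> zq; apply: contra qP => /flattenP[u]; rewrite mem_rev => uP' zu.
    by apply/hasP; exists z => //; apply/flattenP; exists u.
  by rewrite (filter_row sq ir i1r) no // mem_rev.
have notq z : z \in r -> z \notin q.
  move=> zr; apply: contra qP => zq; apply/hasP; exists z => //.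
  by apply/flattenP; exists r.
by rewrite (IHP sP uP rP ir i1r) no ?cats0 // notq.
Qed.

Lemma index_lt_filter (s : seq nat) i :
  filter (pred2 i i.+1) s = [:: i; i.+1] -> index i s < index i.+1 s.
Proof.
elim: s => //= x s IHs; have [->|xi] := eqVneq x i.
  by move=> _; rewrite -[i == i.+1]negbK neq_ltn ltnSn.
have [->|xi1] /= := eqVneq x i.+1; first by case=> /eqP; lia.
exact: IHs.
Qed.

(** The entry x takes the place of a larger one or is appended, so no entry
    less than x is lost, and x itself is gained. *)
Lemma count_row_insert r x :
  count (fun u => u < x) r < count (leq^~ x) (row_insert r x).2.
Proof.
elim: r => [|y r IHr] /=; first by rewrite leqnn.
case: ifP => xy /=.
  have : count (fun u => u < x) r <= count (leq^~ x) r by apply: sub_count => u /ltnW.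
  by lia.
by case: (row_insert r x) IHr => b r' /=; lia.
Qed.

Lemma count_row_insert_mono r x z :
  count (leq^~ z) r <= count (leq^~ z) (row_insert r x).2.
Proof.
elim: r => //= y r IHr; case: ifP => xy /=; first by lia.
by case: (row_insert r x) IHr => b r' /=; lia.
Qed.

Lemma head_tableau_insert P x :
  head [::] (tableau_insert P x) = (row_insert (head [::] P) x).2.
Proof. by case: P => //= r P; case: (row_insert r x) => [[y|] r']. Qed.

(** Schensted's bound, strengthened to an invariant of insertion: the entries of
    the first row that do not exceed the last letter of t are at least as many
    as the letters of t. *)
Lemma increasing_count_first_row s t : subseq t s -> sorted ltn t ->
  size t <= count (leq^~ (last 0 t)) (head [::] (foldl tableau_insert [::] s)).
Proof.
elim/last_ind: s t => [|s x IHs] t; first by move=> /eqP ->.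
rewrite foldl_rcons head_tableau_insert => ts st.
have [ts'|] := boolP (subseq t s).
  exact: leq_trans (IHs t ts' st) (count_row_insert_mono _ _ _).
case/lastP: t ts st => [|t y]; first by rewrite sub0seq.
rewrite -![subseq (rcons _ _) _]subseq_rev !rev_rcons /=.
case: eqP => [->|_ -> //]; rewrite subseq_rev => ts st _.
rewrite size_rcons last_rcons; apply: leq_ltn_trans (count_row_insert _ _).
case: t st ts => // z t; rewrite rcons_cons /= rcons_path => /andP[st lt] ts.
apply: leq_trans (IHs _ ts st) _; apply: sub_count => u /= uz.
exact: leq_ltn_trans uz lt.
Qed.

Lemma increasing_size_first_row s t : subseq t s -> sorted ltn t ->
  size t <= size (nth [::] (foldl tableau_insert [::] s) 0).
Proof.
move=> ts st; rewrite nth0.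
exact: leq_trans (increasing_count_first_row ts st) (count_size _ _).
Qed.

Lemma subseq_of_index (s t : seq nat) : {subset t <= s} ->
  sorted ltn (map (index^~ s) t) -> subseq t s.
Proof.
move=> ts; set idx := map _ t => s_idx.
have idx_s : subseq idx (iota 0 (size s)).
  suff -> : idx = filter (mem idx) (iota 0 (size s)) by exact: filter_subseq.
  apply: (irr_sorted_eq ltn_trans ltnn) => //.
    exact/(sorted_filter ltn_trans)/iota_ltn_sorted.
  move=> q; rewrite mem_filter /= andb_idr // => /mapP[y yt ->].
  by rewrite mem_iota /= index_mem ts.
have := map_subseq (nth 0 s) idx_s; rewrite map_nth_iota0 // take_size -map_comp.
by rewrite map_id_in // => y yt /=; rewrite nth_index // ts.
Qed.

Lemma path_map_iota (f : nat -> nat) a b :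
  (forall i, a <= i < a + b -> f i < f i.+1) ->
  path ltn (f a) (map f (iota a.+1 b)).
Proof.
elim: b a => //= b IHb a inc; rewrite inc /=; last by lia.
by apply: IHb => i; rewrite addSn => ?; apply: inc; lia.
Qed.

(** Used for f = id, where it says that the chosen letters increase, and for f
    the position in the word, where it says that their positions do. *)
Lemma sorted_map_two_runs (f : nat -> nat) k m :
    (forall i, 1 <= i < k.+1 -> f i < f i.+1) -> f k.+1 < f k.+4 ->
    (forall i, k.+4 <= i < k.+4 + m -> f i < f i.+1) ->
  sorted ltn (map f (iota 1 k.+1 ++ iota k.+4 m.+1)).
Proof.
move=> inc1 lt inc2; rewrite map_cat /= cat_path path_map_iota //=.
rewrite path_map_iota // andbT last_map.
suff -> : last 1 (iota 2 k) = k.+1 by [].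
by rewrite (last_nth 0) size_iota -[1 :: _]/(iota 1 k.+1) nth_iota.
Qed.

(** The letters k+1, k+2, k-1, k occur in this order, so that they are a 3412.
    Only the order of k+2 and k-1 is in question; if it were the opposite, the
    letters 1, ..., k-1, k+2, ..., k+m would increase along the word. *)
Theorem insertion_3412 (s : seq nat) k m : uniq s ->
    let T := foldl tableau_insert [::] s in
    {subset iota 1 k <= nth [::] T 0} -> {subset iota k.+1 m <= nth [::] T 1} ->
    1 < k -> 1 < m -> size (nth [::] T 0) < k + m - 2 ->
  [/\ index k.+1 s < index k.+2 s, index k.+2 s < index k.-1 s & index k.-1 s < index k s].
Proof.
move=> us T T0 T1 k_gt m_gt T_lt; have [permT sT wT] := insertion_spec us.
have uT : uniq (flatten T) by rewrite (perm_uniq permT).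
have row_in q i : i \in nth [::] T q -> nth [::] T q \in T.
  move=> iT; apply: mem_nth; rewrite ltnNge; apply/negP => le_q.
  by rewrite nth_default in iT.
have step q i : i \in nth [::] T q -> i.+1 \in nth [::] T q -> index i s < index i.+1 s.
  move=> iT i1T; apply: index_lt_filter; rewrite -wT.
  exact: (reading_word_filter sT uT (row_in _ _ iT) iT i1T).
have in_s q i : i \in nth [::] T q -> i \in s.
  move=> iT; rewrite -(perm_mem permT); apply/flattenP; exists (nth [::] T q) => //.
  exact: row_in iT.
case: k m => [|[|k]] [|[|m]] // in T0 T1 k_gt m_gt T_lt *.
have inc1 i : 0 < i < k.+2 -> index i s < index i.+1 s.
  by move=> ik; apply: (step 0); apply: T0; rewrite mem_iota; lia.
have inc2 i : k.+3 <= i < k.+3 + m.+1 -> index i s < index i.+1 s.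
  by move=> ik; apply: (step 1); apply: T1; rewrite mem_iota; lia.
split; [by apply: inc2; lia | | by apply: inc1; lia].
rewrite ltnNge leq_eqVlt; apply/norP; split.
  apply/eqP => /(congr1 (nth 0 s)); rewrite !nth_index; first by lia.
    by apply/(in_s 1)/T1; rewrite mem_iota; lia.
  by apply/(in_s 0)/T0; rewrite mem_iota; lia.
apply/negP => lt; suff : k + m + 2 <= size (nth [::] T 0) by lia.
have := @increasing_size_first_row s (iota 1 k.+1 ++ iota k.+4 m.+1).
rewrite size_cat !size_iota -/T; have -> : k.+1 + m.+1 = k + m + 2 by lia.
apply.
  apply: subseq_of_index; last first.
    by apply: sorted_map_two_runs => // i ik; [apply: inc1 | apply: inc2]; lia.
  move=> i; rewrite mem_cat !mem_iota => /orP[ik|ik].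
    by apply/(in_s 0)/T0; rewrite mem_iota; lia.
  by apply/(in_s 1)/T1; rewrite mem_iota; lia.
rewrite -[X in sorted _ X]map_id.
by apply: sorted_map_two_runs => [i _||i _]; rewrite /=; lia.
Qed.

(** * Permutations containing 3412 are singular *)

Section Singular.

Variables (F : closedFieldType) (n : nat).
Implicit Type w : 'S_n.

(** The combinatorics of pattern containment is done on functions on nat, where
    deleting an entry does not change types; this is the bridge to 'S_n. *)
Definition nat_perm w (x : nat) : nat :=
  if insub x is Some i then val (w i) else 0.

Lemma nat_perm_val w (i : 'I_n) : nat_perm w i = w i.
Proof. by rewrite /nat_perm valK. Qed.

Lemma nat_perm_inverse w : inverse_below n (nat_perm w) (nat_perm w^-1).
Proof.
move=> x x_n; have -> : x = Ordinal x_n by [].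
by rewrite !nat_perm_val permK permKV !ltn_ord.
Qed.

Lemma card_ord_pairs (P : nat -> nat -> bool) :
  #|[set ij : 'I_n * 'I_n | P ij.1 ij.2]| = \sum_(i < n) \sum_(j < n) P i j.
Proof.
rewrite -sum1dep_card big_mkcond pair_bigA /=; apply: eq_bigr => ij _.
by case: (P _ _).
Qed.

Lemma perm_lengthE w : perm_length w = inversion_count n (nat_perm w).
Proof.
rewrite /inversion_count.
rewrite -(card_ord_pairs (fun i j => (i < j) && (nat_perm w j < nat_perm w i))).
by apply: eq_card => ij; rewrite !inE !nat_perm_val.
Qed.

Lemma transposition_below_tperm w (i j : 'I_n) :
  transposition_below (nat_perm w) (nat_perm w^-1) i j ->
  i < j /\ tperm_below i j w.
Proof.
case/transposition_belowP => ij [a ai ja] [c ci jc]; split=> //.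
have a_n : a < n by exact: leq_ltn_trans ai (ltn_ord i).
have c_n : c < n by exact: leq_ltn_trans ci (ltn_ord i).
apply/andP; split; apply/existsP.
  by exists (Ordinal a_n); rewrite -nat_perm_val /= ai.
exists (w^-1 (Ordinal c_n))%g; rewrite permKV /= ci andbT.
by rewrite -nat_perm_val.
Qed.

Lemma contains_3412_occurs w : contains_3412 w -> occurs3412 n (nat_perm w).
Proof.
move=> [a [b [c [d [[ab bc cd] lt]]]]]; exists a, b, c, d.
by rewrite !nat_perm_val; split.
Qed.

(** The tangent space at the base point 1 contains one independent direction
    for each transposition below w, and there are more of these than the
    dimension. *)
Theorem contains_3412_singular w : contains_3412 w -> ~ smooth F w.
Proof.
move=> /contains_3412_occurs pat smooth_w.
have [_ /(_ (or_introl pat))] := inversion_count_transposition_count (nat_perm_inverse w).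
rewrite -perm_lengthE /transposition_count.
rewrite -(card_ord_pairs (transposition_below (nat_perm w) (nat_perm w^-1))).
set S := [set ij | _] => lt.
have S_below (ij : 'I_n * 'I_n) : ij \in S -> ij.1 < ij.2 /\ tperm_below ij.1 ij.2 w.
  by rewrite inE => /transposition_below_tperm.
have [ij0 /S_below[lt0 below0]] : exists ij, ij \in S.
  by apply/set0Pn; rewrite -card_gt0; exact: leq_ltn_trans lt.
have base : in_schubert w (1%:M : 'M[F]_n).
  apply: (in_schubert_tperm_below lt0 below0).
  by have := in_schubert_transvection (0 : F)%R lt0; rewrite GRing.scale0r GRing.addr0.
have [U [tangentU dimU]] := smooth_w _ base.
suff : #|S| <= \dim U by rewrite dimU leqNgt lt.
apply: dim_ge_delta => ij /S_below[ij_lt below]; apply/tangentU.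
by apply: schubert_tangent_delta => // g; apply: in_schubert_tperm_below.
Qed.

End Singular.

(** * The theorem *)

Lemma index_one_line n (w : 'S_n) (x : 'I_n) :
  index x.+1 (one_line w) = (w^-1 x)%g.
Proof.
rewrite -{1}[x](permKV w) /one_line (index_map (f := fun i => (val (w i)).+1)).
  by rewrite index_enum_ord.
by move=> i j [] /val_inj /perm_inj.
Qed.

Lemma one_line_uniq n (w : 'S_n) : uniq (one_line w).
Proof.
by rewrite map_inj_uniq ?enum_uniq // => i j [] /val_inj /perm_inj.
Qed.

Lemma mem_one_line n (w : 'S_n) x : x \in one_line w -> 0 < x <= n.
Proof. by case/mapP => i _ ->; rewrite ltn_ord. Qed.

Lemma standard_second_row n P : standard_tableau n P ->
  size (nth [::] P 1) <= size (nth [::] P 0).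
Proof.
case: P => [|r [|r' P]] // /and4P[_ _ + _].
by case/andP => /andP[].
Qed.

Theorem proposition4p2 (F : closedFieldType) (n k m : nat) (P : tableau)
    (hP : standard_tableau n P)
    (hk : (0 < k)%N) (hm : (0 < m)%N)
    (hrow1 : take k (nth [::] P 0) = iota 1 k)
    (hrow2 : nth [::] P 1 = iota k.+1 m)
    (hl : (k + m - 2 > size (nth [::] P 0))%N) :
  forall w : 'S_n, w \in right_cell n P -> contains_3412 w /\ ~ smooth F w.
Proof.
move=> w; rewrite inE => /eqP wP.
suff pat : contains_3412 w by split=> //; exact: contains_3412_singular.
have k_le : k <= size (nth [::] P 0).
  by have := congr1 size hrow1; rewrite size_iota size_take; case: ltnP => [/ltnW|_ ->].
have m_le : m <= size (nth [::] P 0).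
  by have := standard_second_row hP; rewrite hrow2 size_iota.
have := @insertion_3412 (one_line w) k m (one_line_uniq w).
rewrite -/(insertion_tableau w) wP => /(_ _ _ ltac:(lia) ltac:(lia) hl)[].
- by move=> x; rewrite -hrow1; apply: mem_take.
- by move=> x; rewrite hrow2.
move=> lt1 lt2 lt3.
have : k.+2 \in one_line w.
  by rewrite -index_mem (leq_trans lt2) // index_size.
move=> /mem_one_line /andP[_ k2_n].
have [k1_n kp_n kpp_n] : [/\ k < n, k.-1 < n & k.-2 < n] by split; lia.
exists (w^-1 (Ordinal k1_n))%g, (w^-1 (Ordinal k2_n))%g,
  (w^-1 (Ordinal kpp_n))%g, (w^-1 (Ordinal kp_n))%g.
rewrite !permKV -!index_one_line /=.
have -> : k.-2.+1 = k.-1 by lia.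
by have -> : k.-1.+1 = k by lia.
Qed.
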